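(* Let $G$ be a simple graph and $n\in\mathbb{Z}^+$. If the chromatic number $\chi(G)$ is finite, then $\chi_{n,0}(G)=\chi(G)$.
   Context: Graphs are simple, possibly infinite, $G=(V,E)$. A labeling (coloring) is a map $\ell:V\to\mathbb{Z}$; its order $|\ell|$ is the size of its image. It is proper if adjacent vertices get different labels; $\chi(G)$ is the minimum order of a proper labeling. For $v\in V$, $N[v]$ is the closed neighborhood ($v$ together with its neighbors). For $k\in\mathbb{Z}$, $n\in\mathbb{Z}^+$, a closed coloring with remainder $k\bmod n$ is a labeling $\ell$ with $\sum_{w\in N[v]}\ell(w)\equiv k\pmod n$ for every $v\in V$. If no proper closed coloring with remainder $k\bmod n$ exists, $\chi_{n,k}(G)$ does not exist; if proper ones of finite order exist, $\chi_{n,k}(G)$ is the minimum order of such a coloring; if they exist only of infinite order, $\chi_{n,k}(G)=\infty$. *)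

(* Defs.v *)
From HB Require Import structures.
From mathcomp Require Import all_boot all_order all_algebra.
From mathcomp Require Import boolp classical_sets functions cardinality fsbigop.

Set Implicit Arguments.
Unset Strict Implicit.
Unset Printing Implicit Defensive.

Import Order.TTheory GRing.Theory Num.Theory.
Local Open Scope classical_set_scope.
Local Open Scope ring_scope.

(* With the axioms of [boolp], every type carries a [choiceType] structure, so
   the vertex set is arbitrary.  No finiteness (of the graph, or of the
   neighborhoods) is assumed. *)
Record simple_graph := SimpleGraph {
  vertex :> choiceType;
  adj : vertex -> vertex -> Prop;
  adj_sym : forall v w, adj v w -> adj w v;
  adj_irrefl : forall v, ~ adj v v }.

Arguments adj {s}.

Definition labeling (G : simple_graph) := G -> int.

Definition proper_labeling (G : simple_graph) (l : labeling G) : Prop :=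
  forall v w, adj v w -> l v <> l w.

Definition has_order (G : simple_graph) (l : labeling G) (m : nat) : Prop :=
  (range l #= `I_m)%card.

Definition closed_nbhd (G : simple_graph) (v : G) : set G :=
  [set w | w = v \/ adj v w].

(* The sum over [N[v]] is a sum modulo [n].  When [N[v]] is infinite it is
   meaningful when all but finitely many terms vanish modulo [n]; the terms
   divisible by [n] are therefore discarded, and finiteness of what remains is
   part of the definition (the finitely supported sum of [fsbigop] would
   otherwise silently be 0).  When [N[v]] is finite this is the plain
   congruence on the integer sum: see [closed_coloring_locally_finite]. *)
Definition nonzero_nbhd (n : nat) (G : simple_graph) (l : labeling G) (v : G) :
    set G :=
  [set w | closed_nbhd v w /\ ~~ (n %| l w)%Z].

Definition closed_coloring (n : nat) (k : int) (G : simple_graph)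
    (l : labeling G) : Prop :=
  forall v : G, finite_set (nonzero_nbhd n l v) /\
    (\sum_(w \in nonzero_nbhd n l v) l w = k %[mod n])%Z.

Lemma closed_coloring_locally_finite (n : nat) (k : int) (G : simple_graph)
    (l : labeling G) (Gfin : forall v : G, finite_set (closed_nbhd v)) :
  closed_coloring n k l <->
  forall v : G, (\sum_(w \in closed_nbhd v) l w = k %[mod n])%Z.
Proof.
have sub v : nonzero_nbhd n l v `<=` closed_nbhd v by move=> w [].
have fin v : finite_set (nonzero_nbhd n l v) by exact: sub_finite_set (Gfin v).
have sumE v : (\sum_(w \in nonzero_nbhd n l v) l w
             = \sum_(w \in closed_nbhd v) l w %[mod n])%Z.
  rewrite [in RHS](fsbigID (nonzero_nbhd n l v)); last exact: Gfin.
  apply/eqP; rewrite eqz_mod_dvd setIidr // opprD addrA subrr add0r rpredN.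
  have finD : finite_set (closed_nbhd v `&` ~` nonzero_nbhd n l v).
    exact: finite_setIl.
  rewrite fsbig_finite //= big_seq.
  elim/big_ind: _ => [|x y nx ny|w]; [exact: dvdz0|exact: rpredD|].
  rewrite in_fset_set // inE => -[Nw nw].
  by apply/negPn/negP => nd; apply: nw.
split=> H v; first by rewrite -sumE; case: (H v).
by split=> //; rewrite sumE.
Qed.

Inductive chromatic_value :=
  | NonExistent
  | FiniteOrder of nat
  | InfiniteOrder.

Definition is_finite (c : chromatic_value) : Prop := exists m, c = FiniteOrder m.

Definition min_order (G : simple_graph) (P : labeling G -> Prop) :
    chromatic_value :=
  let has_order_in_P (m : nat) := `[< exists2 l, P l & has_order l m >] in
  match pselect (exists m, has_order_in_P m) with
  | left finP => FiniteOrder (ex_minn finP)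
  | right _ => if `[< exists l, P l >] then InfiniteOrder else NonExistent
  end.

Definition chi (G : simple_graph) : chromatic_value :=
  min_order (@proper_labeling G).

Definition chi_mod (n : nat) (k : int) (G : simple_graph) : chromatic_value :=
  min_order (fun l : labeling G => proper_labeling l /\ closed_coloring n k l).

(* Main.v *)
Require Import Defs.
From mathcomp Require Import all_boot all_order all_algebra.
From mathcomp Require Import boolp classical_sets functions cardinality fsbigop.

Set Implicit Arguments.
Unset Strict Implicit.
Unset Printing Implicit Defensive.

Import GRing.Theory.

(** Multiplying a proper labeling by [n] keeps it proper and preserves its
    order, and makes every label, hence every sum over a closed neighborhood,
    divisible by [n]. *)

(** Proper closed colorings are proper labelings, and conversely scaling a proper labeling by [n]
    yields a proper closed coloring with remainder 0 and a range of the same cardinality. So both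
    classes attain the same orders, and [eq_min_order] turns this into equality of the minima. *)

Lemma eq_min_order (G : simple_graph) (P Q : labeling G -> Prop) :
  (forall l, P l -> Q l) ->
  (forall l, Q l -> exists2 l', P l' & (range l' #= range l)%card) ->
  min_order P = min_order Q.
Proof.
move=> PQ QP.
have ordE m : `[< exists2 l, P l & has_order l m >] =
              `[< exists2 l, Q l & has_order l m >].
  apply: asbool_equiv_eq; split=> [[l /PQ Ql lm]|[l /QP[l' Pl' l'l] lm]].
    by exists l.
  by exists l' => //; exact: card_eq_trans l'l lm.
have exE : `[< exists l, P l >] = `[< exists l, Q l >].
  apply: asbool_equiv_eq; split=> [[l /PQ Ql]|[l /QP[l' Pl' _]]].
    by exists l.
  by exists l'.
rewrite /min_order exE; case: pselect => finP; case: pselect => finQ //.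
(* By [ordE] the same finite orders are attained, so the minima agree and the two mixed cases are
   contradictory. *)
- by congr FiniteOrder; exact: eq_ex_minn.
- by case: finQ; case: finP => m; rewrite ordE; exists m.
- by case: finP; case: finQ => m; rewrite -ordE; exists m.
Qed.

Definition scale_labeling (n : nat) (G : simple_graph) (l : labeling G) :
  labeling G := fun v => (n%:Z * l v)%R.

(** All labels are multiples of [n], so every term is discarded and the sum is empty, even at a
    vertex of infinite degree. *)
Lemma closed_coloring_scale (n : nat) (G : simple_graph) (l : labeling G) :
  closed_coloring n 0 (scale_labeling n l).
Proof.
move=> v; suff -> : nonzero_nbhd n (scale_labeling n l) v = set0.
  by split; [exact: finite_set0 | rewrite fsbig_set0].
by rewrite -subset0 => w [_]; rewrite dvdz_mulr.
Qed.

Lemma scale_int_inj (n : nat) :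
  (0 < n)%N -> injective (fun x : int => (n%:Z * x)%R).
Proof. by move=> n_gt0; apply: mulfI; rewrite eqz_nat -lt0n. Qed.

Lemma proper_labeling_scale (n : nat) (G : simple_graph) (l : labeling G) :
  (0 < n)%N -> proper_labeling l -> proper_labeling (scale_labeling n l).
Proof. by move=> n_gt0 lP v w /lP lvw /(scale_int_inj n_gt0). Qed.

Lemma card_range_scale (n : nat) (G : simple_graph) (l : labeling G) :
  (0 < n)%N -> (range (scale_labeling n l) #= range l)%card.
Proof.
move=> n_gt0.
have -> :
    range (scale_labeling n l) = [set (n%:Z * x)%R | x in range l]%classic.
  by rewrite image_comp.
exact: inj_card_eq (in2W (scale_int_inj n_gt0)).
Qed.

Theorem theorem3p1 (G : simple_graph) (n : nat) (n_gt0 : (0 < n)%N)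
    (chi_fin : is_finite (chi G)) :
  chi_mod n 0%R G = chi G.
Proof.
apply: eq_min_order => [l [] //|l lP]; exists (scale_labeling n l).
  by split; [exact: proper_labeling_scale | exact: closed_coloring_scale].
exact: card_range_scale.
Qed.
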